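(* Let $(\mathsf{C},\bullet)$ be a linear symmetric monoidal category, with symmetry $\sigma\colon X\bullet Y\to Y\bullet X$. (i) If $(D,\prec,\succ)$ is a dendriform monoid in $\mathsf{C}$, then the map $\circ\colon D\bullet D\to D$ defined by $\circ\;=\;\succ-\prec\sigma$ turns $D$ into a left pre-Lie monoid in $\mathsf{C}$. (ii) Let $(D,\prec,\succ)$ be a dendriform monoid in $\mathsf{C}$ for which $\succ\;=\;\prec\sigma$ as maps $D\bullet D\to D$. Then the map $\ast\colon D\bullet D\to D$ defined by $\ast\;=\;\succ$ turns $D$ into a left zinbiel monoid in $\mathsf{C}$. (iii) Let $(Z,\ast)$ be a left zinbiel monoid in $\mathsf{C}$. Then the maps $Z\bullet Z\to Z$ defined by $\prec\;=\;\ast\,\sigma$ and $\succ\;=\;\ast$ turn $Z$ into a dendriform monoid in $\mathsf{C}$. Moreover, $\succ\;=\;\prec\sigma$ as maps $Z\bullet Z\to Z$.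
   Context: Let $\mathbb{K}$ be a field. A linear monoidal category $(\mathsf{C},\bullet)$ is a (not necessarily unital) monoidal category whose hom-sets are $\mathbb{K}$-vector spaces and for which composition and the tensor product $\bullet$ of morphisms are $\mathbb{K}$-bilinear. Associativity constraints are suppressed. Juxtaposition of maps, such as $\prec\sigma$, denotes composition. A dendriform monoid in $\mathsf{C}$ is an object $D$ with maps $\prec,\succ\colon D\bullet D\to D$ such that, writing $\cdot=\prec+\succ$, the following hold as maps $D\bullet D\bullet D\to D$: $$\prec(\prec\bullet\,\mathrm{id})=\;\prec(\mathrm{id}\bullet\cdot),\qquad \prec(\succ\bullet\,\mathrm{id})=\;\succ(\mathrm{id}\bullet\prec),\qquad \succ(\cdot\bullet\mathrm{id})=\;\succ(\mathrm{id}\bullet\succ).$$ A left zinbiel monoid in $\mathsf{C}$ is an object $Z$ with a map $\ast\colon Z\bullet Z\to Z$ such that $$\ast(\mathrm{id}\bullet\ast)=\ast(\ast\bullet\mathrm{id})+\ast(\ast\bullet\mathrm{id})(\sigma\bullet\mathrm{id})$$ (in terms of elements: $x\ast(y\ast z)=(x\ast y)\ast z+(y\ast x)\ast z$). A left pre-Lie monoid in $\mathsf{C}$ is an object $P$ with a map $\circ\colon P\bullet P\to P$ such that $$\circ(\mathrm{id}\bullet\circ)-\circ(\circ\bullet\mathrm{id})=\big(\circ(\mathrm{id}\bullet\circ)-\circ(\circ\bullet\mathrm{id})\big)(\sigma\bullet\mathrm{id})$$ (in terms of elements: $x\circ(y\circ z)-(x\circ y)\circ z=y\circ(x\circ z)-(y\circ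 x)\circ z$). *)

(* Defs.v *)
From mathcomp Require Import all_boot all_algebra.

Set Implicit Arguments.
Unset Strict Implicit.
Unset Printing Implicit Defensive.

Import GRing.Theory.

Declare Scope linmon_scope.
Delimit Scope linmon_scope with linmon.
Local Open Scope ring_scope.
Local Open Scope linmon_scope.

Reserved Notation "g ∘ f" (at level 40, left associativity).
Reserved Notation "X • Y" (at level 35, right associativity).
Reserved Notation "f •m g" (at level 35, right associativity).

(** Composition is written in the usual order: [mcomp g f] is "g after f". *)
Record linCategory (K : fieldType) := LinCategory {
  ob :> Type;
  mor : ob -> ob -> lmodType K;
  idm : forall X, mor X X;
  mcomp : forall X Y Z, mor Y Z -> mor X Y -> mor X Z;
  mcompA : forall W X Y Z (h : mor Y Z) (g : mor X Y) (f : mor W X),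
    mcomp h (mcomp g f) = mcomp (mcomp h g) f;
  mcomp_idl : forall X Y (f : mor X Y), mcomp (idm Y) f = f;
  mcomp_idr : forall X Y (f : mor X Y), mcomp f (idm X) = f;
  mcomp_linearl : forall X Y Z (f : mor X Y),
    linear (fun g : mor Y Z => mcomp g f);
  mcomp_linearr : forall X Y Z (g : mor Y Z),
    linear (fun f : mor X Y => mcomp g f)
}.

Arguments mor {K} _ _ _.
Arguments idm {K _} X.
Arguments mcomp {K _ X Y Z} g f.

Notation "g ∘ f" := (mcomp g f) : linmon_scope.

(** No unit object is required.  The associator, suppressed in informal
    notation, is explicit here: a natural isomorphism satisfying the pentagon
    identity. *)
Record linMonCategory (K : fieldType) := LinMonCategory {
  lincat :> linCategory K;
  tens : lincat -> lincat -> lincat;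
  tensm : forall X X' Y Y',
    mor lincat X X' -> mor lincat Y Y' -> mor lincat (tens X Y) (tens X' Y');
  tensm_id : forall X Y, tensm (idm X) (idm Y) = idm (tens X Y);
  tensm_comp : forall X X' X'' Y Y' Y''
      (f' : mor lincat X' X'') (f : mor lincat X X')
      (g' : mor lincat Y' Y'') (g : mor lincat Y Y'),
    tensm (f' ∘ f) (g' ∘ g) = tensm f' g' ∘ tensm f g;
  tensm_linearl : forall X X' Y Y' (g : mor lincat Y Y'),
    linear (fun f : mor lincat X X' => tensm f g);
  tensm_linearr : forall X X' Y Y' (f : mor lincat X X'),
    linear (fun g : mor lincat Y Y' => tensm f g);
  associator : forall X Y Z,
    mor lincat (tens (tens X Y) Z) (tens X (tens Y Z));
  associator_inv : forall X Y Z,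
    mor lincat (tens X (tens Y Z)) (tens (tens X Y) Z);
  associatorK : forall X Y Z, associator_inv X Y Z ∘ associator X Y Z = idm _;
  associator_invK : forall X Y Z, associator X Y Z ∘ associator_inv X Y Z = idm _;
  associator_nat : forall X X' Y Y' Z Z'
      (f : mor lincat X X') (g : mor lincat Y Y') (h : mor lincat Z Z'),
    associator X' Y' Z' ∘ tensm (tensm f g) h
    = tensm f (tensm g h) ∘ associator X Y Z;
  pentagon : forall W X Y Z,
    associator W X (tens Y Z) ∘ associator (tens W X) Y Z
    = tensm (idm W) (associator X Y Z) ∘ associator W (tens X Y) Z
      ∘ tensm (associator W X Y) (idm Z)
}.

Arguments tens {K _} X Y.
Arguments tensm {K _ X X' Y Y'} f g.
Arguments associator {K _} X Y Z.
Arguments associator_inv {K _} X Y Z.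

Notation "X • Y" := (tens X Y) : linmon_scope.
Notation "f •m g" := (tensm f g) : linmon_scope.

(** Since the braiding is its own inverse, one hexagon identity implies the
    other. *)
Record symLinMonCategory (K : fieldType) := SymLinMonCategory {
  linmoncat :> linMonCategory K;
  symm : forall X Y : linmoncat, mor linmoncat (X • Y) (Y • X);
  symm_nat : forall (X X' Y Y' : linmoncat)
      (f : mor linmoncat X X') (g : mor linmoncat Y Y'),
    symm X' Y' ∘ (f •m g) = (g •m f) ∘ symm X Y;
  symmK : forall X Y : linmoncat, symm Y X ∘ symm X Y = idm (X • Y);
  hexagon : forall X Y Z : linmoncat,
    associator Y Z X ∘ symm X (Y • Z) ∘ associator X Y Z
    = (idm Y •m symm X Z) ∘ associator Y X Z ∘ (symm X Y •m idm Z)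
}.

Arguments symm {K _} X Y.

(** In the axioms below both sides are maps out of [(D • D) • D]; terms that
    are naturally maps out of [D • (D • D)] are precomposed with the
    associator. *)

Definition dendriform_monoid (K : fieldType) (C : linMonCategory K) (D : C)
    (prec succ : mor C (D • D) D) : Prop :=
  let dot := prec + succ in
  [/\ prec ∘ (prec •m idm D) = prec ∘ (idm D •m dot) ∘ associator D D D,
      prec ∘ (succ •m idm D) = succ ∘ (idm D •m prec) ∘ associator D D D
    & succ ∘ (dot •m idm D) = succ ∘ (idm D •m succ) ∘ associator D D D].

Definition left_zinbiel_monoid (K : fieldType) (C : symLinMonCategory K)
    (Z : C) (ast : mor C (Z • Z) Z) : Prop :=
  ast ∘ (idm Z •m ast) ∘ associator Z Z Z
  = ast ∘ (ast •m idm Z) + ast ∘ (ast •m idm Z) ∘ (symm Z Z •m idm Z).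

Definition left_preLie_monoid (K : fieldType) (C : symLinMonCategory K)
    (P : C) (circ : mor C (P • P) P) : Prop :=
  let a := circ ∘ (idm P •m circ) ∘ associator P P P - circ ∘ (circ •m idm P) in
  a = a ∘ (symm P P •m idm P).

(* Main.v *)
(** Maps out of [(D • D) • D] carry a right action of the adjacent
    transpositions [s1] and [s2].  The hexagon identity expresses the symmetries
    between [D • D] and [D] as [s1 ∘ s2] and [s2 ∘ s1], and naturality of the
    symmetry then gives the braid relation.  Hence a composite of two binary
    maps, one of them precomposed with the symmetry, is again a composite of the
    bare maps followed by a word in [s1] and [s2]; the three parts become
    identities between linear combinations of such terms. *)
Require Import Defs.
From mathcomp Require Import all_boot all_algebra.

Local Open Scope ring_scope.
Local Open Scope linmon_scope.

Import GRing.Theory.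

Section LinearMaps.
Context {K : fieldType}.

Lemma linear_fun_add (U V : lmodType K) (f : U -> V) :
  linear f -> {morph f : x y / x + y}.
Proof. by move=> lin_f x y; have := lin_f 1 x y; rewrite !scale1r. Qed.

Lemma linear_fun_opp (U V : lmodType K) (f : U -> V) :
  linear f -> {morph f : x / - x}.
Proof.
move=> lin_f x; have f0: f 0 = 0.
  by apply: (addrI (f 0)); rewrite -(linear_fun_add _ _ _ lin_f) !addr0.
by have := lin_f (-1) x 0; rewrite !scaleN1r f0 !addr0.
Qed.

Context {C : linMonCategory K}.
Implicit Types X Y Z : C.

Lemma mcompDl X Y Z (g h : mor C Y Z) (f : mor C X Y) :
  (g + h) ∘ f = g ∘ f + h ∘ f.
Proof. exact: (linear_fun_add _ _ _ (mcomp_linearl f)). Qed.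

Lemma mcompDr X Y Z (g : mor C Y Z) (f h : mor C X Y) :
  g ∘ (f + h) = g ∘ f + g ∘ h.
Proof. exact: (linear_fun_add _ _ _ (mcomp_linearr g)). Qed.

Lemma mcompNl X Y Z (g : mor C Y Z) (f : mor C X Y) : (- g) ∘ f = - (g ∘ f).
Proof. exact: (linear_fun_opp _ _ _ (mcomp_linearl f)). Qed.

Lemma mcompNr X Y Z (g : mor C Y Z) (f : mor C X Y) : g ∘ (- f) = - (g ∘ f).
Proof. exact: (linear_fun_opp _ _ _ (mcomp_linearr g)). Qed.

Lemma tensmDl X X' Y Y' (f h : mor C X X') (g : mor C Y Y') :
  (f + h) •m g = (f •m g) + (h •m g).
Proof. exact: (linear_fun_add _ _ _ (tensm_linearl g)). Qed.

Lemma tensmDr X X' Y Y' (f : mor C X X') (g h : mor C Y Y') :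
  f •m (g + h) = (f •m g) + (f •m h).
Proof. exact: (linear_fun_add _ _ _ (tensm_linearr f)). Qed.

Lemma tensmNl X X' Y Y' (f : mor C X X') (g : mor C Y Y') :
  (- f) •m g = - (f •m g).
Proof. exact: (linear_fun_opp _ _ _ (tensm_linearl g)). Qed.

Lemma tensmNr X X' Y Y' (f : mor C X X') (g : mor C Y Y') :
  f •m (- g) = - (f •m g).
Proof. exact: (linear_fun_opp _ _ _ (tensm_linearr f)). Qed.

End LinearMaps.

Section Ternary.
Context {K : fieldType} {C : symLinMonCategory K} {D : C}.
Implicit Types f g h : mor C (D • D) D.

(** These are the operadic partial compositions at the first and the second input; [rcomp] carries
    the associator so that both have the same source. *)
Definition lcomp f g : mor C ((D • D) • D) D := f ∘ (g •m idm D).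

Definition rcomp f g : mor C ((D • D) • D) D :=
  f ∘ (idm D •m g) ∘ associator D D D.

Definition s1 : mor C ((D • D) • D) ((D • D) • D) := symm D D •m idm D.

(** Conjugation by the associator lets the swap of the last two factors act on the same bracketing
    as [s1]. *)
Definition s2 : mor C ((D • D) • D) ((D • D) • D) :=
  associator_inv D D D ∘ (idm D •m symm D D) ∘ associator D D D.

Lemma lcompDl f g h : lcomp (f + g) h = lcomp f h + lcomp g h.
Proof. exact: mcompDl. Qed.

Lemma lcompDr f g h : lcomp f (g + h) = lcomp f g + lcomp f h.
Proof. by rewrite /lcomp tensmDl mcompDr. Qed.

Lemma lcompNl f g : lcomp (- f) g = - lcomp f g.
Proof. exact: mcompNl. Qed.

Lemma lcompNr f g : lcomp f (- g) = - lcomp f g.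
Proof. by rewrite /lcomp tensmNl mcompNr. Qed.

Lemma rcompDl f g h : rcomp (f + g) h = rcomp f h + rcomp g h.
Proof. by rewrite /rcomp !mcompDl. Qed.

Lemma rcompDr f g h : rcomp f (g + h) = rcomp f g + rcomp f h.
Proof. by rewrite /rcomp tensmDr mcompDr mcompDl. Qed.

Lemma rcompNl f g : rcomp (- f) g = - rcomp f g.
Proof. by rewrite /rcomp !mcompNl. Qed.

Lemma rcompNr f g : rcomp f (- g) = - rcomp f g.
Proof. by rewrite /rcomp tensmNr mcompNr mcompNl. Qed.

Lemma s1K : s1 ∘ s1 = idm _.
Proof. by rewrite /s1 -tensm_comp symmK mcomp_idl tensm_id. Qed.

Lemma associator_s2 :
  associator D D D ∘ s2 = (idm D •m symm D D) ∘ associator D D D.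
Proof. by rewrite /s2 !mcompA associator_invK mcomp_idl. Qed.

Lemma s2K : s2 ∘ s2 = idm _.
Proof.
rewrite {1}/s2 -!mcompA associator_s2 [(_ •m _) ∘ _]mcompA -tensm_comp symmK.
by rewrite mcomp_idl tensm_id mcomp_idl associatorK.
Qed.

Lemma symm_s2s1 : symm D (D • D) ∘ associator D D D = s2 ∘ s1.
Proof.
rewrite /s2 /s1 -!mcompA [(idm D •m _) ∘ (_ ∘ _)]mcompA -hexagon.
by rewrite !mcompA associatorK mcomp_idl.
Qed.

(** This is the other hexagon: both sides invert the map of [symm_s2s1], since [symm], [s1] and [s2]
    are involutive. *)
Lemma symm_s1s2 : associator_inv D D D ∘ symm (D • D) D = s1 ∘ s2.
Proof.
have inv: (s1 ∘ s2) ∘ (symm D (D • D) ∘ associator D D D) = idm _.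
  by rewrite symm_s2s1 mcompA -[s1 ∘ s2 ∘ s2]mcompA s2K mcomp_idr s1K.
rewrite -[LHS]mcomp_idl -inv -[LHS](mcompA (s1 ∘ s2)).
rewrite -[in LHS](mcompA _ (associator _ _ _)) (mcompA (associator _ _ _)).
by rewrite associator_invK mcomp_idl symmK !mcomp_idr.
Qed.

(** Naturality of [symm (D • D) D] in its first argument, applied to the map [symm D D]. *)
Lemma braid : s1 ∘ s2 ∘ s1 = s2 ∘ s1 ∘ s2.
Proof.
rewrite -symm_s1s2 -[LHS]mcompA /s1 symm_nat -[RHS]mcompA -symm_s1s2 /s2.
by rewrite -!mcompA [associator D D D ∘ _]mcompA associator_invK mcomp_idl.
Qed.

Lemma lcomp_symmr f g : lcomp f (g ∘ symm D D) = lcomp f g ∘ s1.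
Proof. by rewrite /lcomp /s1 -mcompA -tensm_comp mcomp_idl. Qed.

Lemma rcomp_symmr f g : rcomp f (g ∘ symm D D) = rcomp f g ∘ s2.
Proof.
rewrite /rcomp -[RHS]mcompA associator_s2 mcompA -[in RHS](mcompA f).
by rewrite -tensm_comp mcomp_idl.
Qed.

(** Naturality slides [g] past the symmetry into the other tensor factor; the symmetry left over is
    [s1 ∘ s2]. *)
Lemma lcomp_symml f g : lcomp (f ∘ symm D D) g = rcomp f g ∘ (s1 ∘ s2).
Proof.
rewrite /lcomp /rcomp -symm_s1s2 -[LHS]mcompA symm_nat -[RHS]mcompA.
by rewrite [associator D D D ∘ _]mcompA associator_invK mcomp_idl mcompA.
Qed.

Lemma rcomp_symml f g : rcomp (f ∘ symm D D) g = lcomp f g ∘ (s2 ∘ s1).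
Proof.
by rewrite /rcomp /lcomp -symm_s2s1 -(mcompA f) symm_nat !mcompA.
Qed.

End Ternary.

Theorem proposition3p2 (K : fieldType) (C : symLinMonCategory K) :
  (forall (D : C) (prec succ : mor C (D • D) D),
      dendriform_monoid prec succ ->
      left_preLie_monoid (succ - prec ∘ symm D D)) /\
  (forall (D : C) (prec succ : mor C (D • D) D),
      dendriform_monoid prec succ ->
      succ = prec ∘ symm D D ->
      left_zinbiel_monoid succ) /\
  (forall (Z : C) (ast : mor C (Z • Z) Z),
      left_zinbiel_monoid ast ->
      let prec := ast ∘ symm Z Z in
      let succ := ast in
      dendriform_monoid prec succ /\ succ = prec ∘ symm Z Z).
Proof.
have symmKr (D : C) (f : mor C (D • D) D) : f = f ∘ symm D D ∘ symm D D.
  by rewrite -mcompA symmK mcomp_idr.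
split; [|split].
- move=> D p s [].
  rewrite -/(lcomp p p) -/(rcomp p (p + s)) -/(lcomp p s) -/(rcomp s p).
  rewrite -/(lcomp s (p + s)) -/(rcomp s s) rcompDr lcompDr => Epp Eps Ess.
  set c := s - p ∘ symm D D.
  rewrite /left_preLie_monoid -/(lcomp c c) -/(rcomp c c) -/(@s1 K C D).
  (* The second and first axioms turn the [lcomp] terms created by [rcomp_symml] back into [rcomp]
     terms. *)
  have Rcc : rcomp c c = rcomp s s - rcomp s p ∘ s2 - rcomp s p ∘ (s2 ∘ s1)
      + (rcomp p p + rcomp p s) ∘ (s1 ∘ s2 ∘ s1).
    rewrite /c rcompDl !rcompDr !rcompNl !rcompNr !rcomp_symml !rcomp_symmr.
    by rewrite lcomp_symmr Eps Epp opprK addrA -(mcompA _ s1) (mcompA s1).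
  have Lcc : lcomp c c = lcomp s s - lcomp s p ∘ s1 - rcomp p s ∘ (s1 ∘ s2)
      + rcomp p p ∘ (s1 ∘ s2 ∘ s1).
    rewrite /c lcompDl !lcompDr !lcompNl !lcompNr !lcomp_symml !lcomp_symmr.
    by rewrite rcomp_symmr opprK addrA -(mcompA _ s2) (mcompA s2) -braid.
  (* By the third axiom [rcomp s s - lcomp s s] is [lcomp s p], and the [rcomp p p] terms cancel. In
     each of the three groups left, precomposition with [s1] swaps the two summands. *)
  have -> : rcomp c c - lcomp c c = (lcomp s p + lcomp s p ∘ s1)
      - (rcomp s p ∘ s2 + rcomp s p ∘ (s2 ∘ s1))
      + (rcomp p s ∘ (s1 ∘ s2 ∘ s1) + rcomp p s ∘ (s1 ∘ s2)).
    rewrite Rcc Lcc -Ess mcompDl !opprD !opprK.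
    rewrite [LHS](AC (4*2*4) ((1*8)*(3*4)*(6*9)*(2*7)*(5*10))) /=.
    by rewrite !subrr !addr0.
  rewrite !(mcompDl, mcompNl) -(mcompA _ s1 s1) s1K mcomp_idr.
  rewrite -(mcompA (rcomp s p) s2) -(mcompA _ (s2 ∘ s1)) -(mcompA s2 s1 s1).
  rewrite -(mcompA _ (s1 ∘ s2 ∘ s1)) -(mcompA (s1 ∘ s2) s1 s1).
  rewrite -(mcompA (rcomp p s) (s1 ∘ s2)) s1K !mcomp_idr.
  by congr (_ - _ + _); rewrite addrC.
- move=> D p s [_ _ +] Es; rewrite -/(lcomp s (p + s)) -/(rcomp s s) lcompDr.
  (* After this substitution the third dendriform axiom is the zinbiel identity. *)
  have -> : p = s ∘ symm D D by rewrite Es -symmKr.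
  rewrite lcomp_symmr => E.
  by rewrite /left_zinbiel_monoid -/(rcomp s s) -E addrC.
move=> Z t; rewrite /left_zinbiel_monoid -/(rcomp t t) -/(lcomp t t).
rewrite -/(@s1 K C Z) => E; split; last exact: symmKr.
set p := t ∘ symm Z Z.
split; rewrite -?/(lcomp p p) -?/(rcomp p (p + t)) -?/(lcomp p t)
  -?/(rcomp t p) -?/(lcomp t (p + t)) -?/(rcomp t t).
(* Both sides reduce to [lcomp t t] acted on by [s2 ∘ s1] plus [s1 ∘ s2 ∘ s1]. *)
- rewrite /p rcompDr lcomp_symml !rcomp_symml rcomp_symmr lcomp_symmr E.
  rewrite -(mcompA _ s2) (mcompA s2) -braid mcompDl -(mcompA _ s1).
  rewrite -(mcompA s1 s2) (mcompA s1 s1) s1K mcomp_idl.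
  by rewrite -(mcompA _ s1 (s2 ∘ s1)) addrC.
(* Here both sides are [lcomp t t] acted on by [s2] plus [s1 ∘ s2]. *)
- rewrite /p lcomp_symml rcomp_symmr E !mcompDl mcompA addrC.
  by rewrite -(mcompA _ s1) (mcompA s1) s1K mcomp_idl.
- by rewrite lcompDr lcomp_symmr E addrC.
Qed.
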